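(* Let $\epsilon\in(0,e^{-e^2})$. Suppose that $T_n$ is a uniform attachment tree with seed $S_\ell=E_\ell$ (a star on $\ell$ vertices), where $\ell\ge 1$ is an integer with $$\ell\le \frac{\log(1/\epsilon)}{\log\log(1/\epsilon)}.$$ Then, for all $n\ge 2\ell$, any seed-finding algorithm that outputs a vertex set $H_n$ of size $\ell$ satisfies $$\mathbb{P}\left\{ |H_n\cap E_\ell|\le \frac{\ell}{2}\right\}\ge \epsilon .$$
   Context: Uniform attachment tree with seed: let $\ell\ge 1$ and let $S_\ell$ be a tree on the vertex set $\{1,\ldots,\ell\}$. For $n>\ell$, a random tree $T_n$ on $\{1,\ldots,n\}$ is a uniform attachment tree with seed $S_\ell$ if it is generated as follows: $T_\ell=S_\ell$; and for $\ell<i\le n$, $T_i$ is obtained from $T_{i-1}$ by joining vertex $i$ by an edge to a vertex of $T_{i-1}$ chosen uniformly at random, independently of all previous choices. Star: $E_\ell$ is a tree on the vertex set $\{1,\ldots,\ell\}$ that has $\ell-1$ vertices of degree one and one vertex of degree $\ell-1$ (for $\ell=1$ a single vertex, for $\ell=2$ a single edge). The seed is identified with its vertex set, so $|H_n\cap E_\ell|=|H_n\cap\{1,\ldots,\ell\}|$. Seed-finding algorithm: it observes $T_n$ with the vertex labels hidden (it may depend on $n$, $\ell$, $\epsilon$ and on the knowledge that the seed is a star on $\ell$ vertices) and outputs a set $H_n$ of vertices of the observed tree. Formally: let $\sigma$ be a uniformly random permutation of $\{1,\ldots,n\}$ independent of $T_n$; the algorithm is a (possibly randomized, with independent randomness)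 map $A$ from trees on $\{1,\ldots,n\}$ to subsets of $\{1,\ldots,n\}$, applied to the relabeled tree $\sigma(T_n)$, and $H_n=\sigma^{-1}(A(\sigma(T_n)))$. *)

(* Defs.v *)
From HB Require Import structures.
From mathcomp Require Import all_boot all_order all_fingroup all_algebra.
From mathcomp Require Import all_classical all_reals all_analysis.

Set Implicit Arguments.
Unset Strict Implicit.
Unset Printing Implicit Defensive.

(* Vertices are numbered from 0: the vertex set {1, ..., n} is 'I_n, and the
   vertex called i.+1 on paper is the ordinal of value i. *)

(* A graph on 'I_n is its set of edges, an edge being a set of vertices; that
   edges have exactly two endpoints is part of [is_tree]. *)
Definition graph (n : nat) := {set {set 'I_n}}.

Definition adj n (G : graph n) : rel 'I_n := fun x y => [set x; y]%SET \in G.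

Definition degree n (G : graph n) (v : 'I_n) : nat := #|[set e in G | v \in e]|.

(* [ucycle] also accepts x, y, x along a single edge, so that only cycles of
   length at least 3 are forbidden. *)
Definition is_tree n (G : graph n) : Prop :=
  [/\ forall e, e \in G -> #|e| = 2,
      forall x y : 'I_n, connect (adj G) x y
    & forall c : seq 'I_n, ucycle (adj G) c -> size c <= 2].

Definition is_star n (G : graph n) : Prop :=
  is_tree G /\
  exists c : 'I_n, degree G c = n.-1 /\
    forall v : 'I_n, v != c -> degree G v = 1.

(* Joins a new vertex, the largest one, to the vertex u. *)
Definition attach n (G : graph n) (u : 'I_n) : graph n.+1 :=
  let w := widen_ord (leqnSn n) in
  ([set w @: e | e : {set 'I_n} in G] :|: [set [set w u; ord_max]])%SET.

Definition relabel n (s : 'S_n) (G : graph n) : graph n :=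
  [set s @: e | e : {set 'I_n} in G]%SET.

Section RandomElements.
Context {d : measure_display} {Omega : measurableType d} {R : realType}.
Variable P : probability Omega R.

(* Random elements of countable types carrying the discrete sigma-algebra. *)
Definition discrete_rv (T : Type) (X : Omega -> T) : Prop :=
  forall B : set T, measurable (X @^-1` B)%classic.

Definition uniform_rv (T : finType) (X : Omega -> T) : Prop :=
  discrete_rv X /\
  forall x : T, P (X @^-1` [set x])%classic = ((#|T|%:R : R)^-1)%:E%R.

Definition independent_rv (T1 T2 : Type) (X : Omega -> T1) (Y : Omega -> T2)
    : Prop :=
  forall (A : set T1) (B : set T2),
    P (X @^-1` A `&` Y @^-1` B)%classic
    = (P (X @^-1` A)%classic * P (Y @^-1` B)%classic)%E.

(* (T i) for l <= i <= n is the growing tree on i vertices, started from the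
   seed S (the values T i for other i are irrelevant).  The tree with i.+2
   vertices arises from the one with i.+1 vertices by joining its new vertex to
   U i; the choices preceding U i are U j with l <= j.+1 < i.+1. *)
Definition uniform_attachment (l : nat) (S : graph l) (n : nat)
    (T : forall i : nat, Omega -> graph i) : Prop :=
  (forall omega, T l omega = S) /\
  exists U : forall i : nat, Omega -> 'I_i.+1,
    forall i : nat, l <= i.+1 < n ->
      [/\ uniform_rv (U i),
          independent_rv
            (fun omega => [seq (U j omega : nat) | j <- index_iota l.-1 i])
            (U i)
        & forall omega, T i.+2 omega = attach (T i.+1 omega) (U i omega)].

(* A randomized algorithm is a random map A, independent of the pair formed by
   the tree and the relabeling that hides its vertex labels; this pair consists
   of a tree and an independent uniform permutation. Only the values of A on
   trees are constrained. *)
Definition seed_finding_algorithm (n l : nat) (Tn : Omega -> graph n)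
    (sigma : Omega -> 'S_n) (A : Omega -> {ffun graph n -> {set 'I_n}})
    : Prop :=
  [/\ uniform_rv sigma, independent_rv Tn sigma,
      discrete_rv A,
      independent_rv (fun omega => (Tn omega, sigma omega)) A
    & forall omega (t : graph n), is_tree t -> #|A omega t| = l].

(* The output, mapped back to the original labels. *)
Definition output n (Tn : Omega -> graph n) (sigma : Omega -> 'S_n)
    (A : Omega -> {ffun graph n -> {set 'I_n}}) (omega : Omega) : {set 'I_n} :=
  ((sigma omega)^-1%g @: A omega (relabel (sigma omega) (Tn omega)))%SET.

End RandomElements.

Definition seed_vertices (n l : nat) : {set 'I_n} := [set v : 'I_n | v < l]%SET.

(* Main.v *)
Require Import Defs.
From HB Require Import structures.
From mathcomp Require Import all_boot all_order all_fingroup all_algebra.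
From mathcomp Require Import all_classical all_reals all_analysis.
From mathcomp Require Import zify lra.

(* If vertex l (counting from 0) attaches to the centre c of the seed star and
   vertices l+1, ..., 2l-1 all attach to vertex l, then the tree on 2l vertices
   consists of two stars on l vertices whose centres are joined by an edge.
   This has probability 1 / (l (l+1) ... (2l-1)).  Conditionally on it, the law
   of the final tree is invariant under an automorphism s of this double star
   that exchanges the two stars and fixes the later vertices.  Since the labels
   are hidden, the output H and its image s H are equally likely; the seed and
   its image under s being disjoint, one of H and s H contains at most half of
   the seed.  Hence the failure probability is at least
   1 / (2 l (l+1) ... (2l-1)) >= (2l)^-l >= eps. *)

Set Implicit Arguments.
Unset Strict Implicit.
Unset Printing Implicit Defensive.
Import Order.TTheory GRing.Theory Num.Theory.
Local Open Scope set_scope.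

(** * Attaching a leaf and relabelling vertices *)

Lemma adj_sym n (G : graph n) : symmetric (adj G).
Proof. by move=> x y; rewrite /adj finset.setUC. Qed.

Section Graphs.
Variable n : nat.
Implicit Types (G : graph n) (u x y : 'I_n).
Let w : 'I_n -> 'I_n.+1 := widen_ord (leqnSn n).

Lemma widen_neq_max x : w x != ord_max.
Proof. by rewrite -val_eqE /= neq_ltn ltn_ord. Qed.

Lemma widen_inj : injective w.
Proof. by move=> x y /(congr1 val) /= /val_inj. Qed.

Variant widen_spec : 'I_n.+1 -> Type :=
  | WidenMax : widen_spec ord_max
  | WidenOrd x : widen_spec (w x).

Lemma widenP v : widen_spec v.
Proof.
have [->|v_max] := eqVneq v ord_max; first by constructor.
have lt_vn : v < n by rewrite ltn_neqAle -ltnS ltn_ord andbT.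
by rewrite (_ : v = w (Ordinal lt_vn)); [constructor | apply: val_inj].
Qed.

Lemma max_notin_imset_widen (e : {set 'I_n}) : ord_max \notin w @: e.
Proof.
by apply/imsetP => -[x _ eq_x]; have := widen_neq_max x; rewrite -eq_x eqxx.
Qed.

Lemma imset_widen_attach G u (e : {set 'I_n}) :
  (w @: e \in attach G u) = (e \in G).
Proof.
rewrite inE mem_imset; last exact: imset_inj widen_inj.
have -> : (w @: e \in [set [set w u; ord_max]]) = false; last by rewrite orbF.
apply/negbTE; rewrite inE; apply: contraTneq (max_notin_imset_widen e) => ->.
by rewrite negbK !inE eqxx orbT.
Qed.

Lemma adj_attach_widen G u x y : adj (attach G u) (w x) (w y) = adj G x y.
Proof. by rewrite /adj -(imset_widen_attach G u) imsetU1 imset_set1. Qed.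

Lemma adj_attach_max G u x : adj (attach G u) ord_max (w x) = (x == u).
Proof.
rewrite /adj inE.
have -> : ([set ord_max; w x] \in [set w @: e | e : {set 'I_n} in G]) = false.
  apply/negbTE/imsetP => -[e _ eq_e].
  by have := max_notin_imset_widen e; rewrite -eq_e !inE eqxx.
apply/set1P/eqP => [|->]; last by rewrite finset.setUC.
move/setP/(_ (w x)); rewrite !inE eqxx orbT (negbTE (widen_neq_max x)) orbF.
by move/esym/eqP/widen_inj.
Qed.

Lemma adj_attach_max_max G u : adj (attach G u) ord_max ord_max = false.
Proof.
apply/negbTE; rewrite /adj finset.setUid !inE negb_or; apply/andP; split.
  apply/imsetP => -[e _ eq_e].
  by have := max_notin_imset_widen e; rewrite -eq_e !inE eqxx.
apply/eqP => /setP/(_ (w u)).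
by rewrite !inE eqxx (negbTE (widen_neq_max u)).
Qed.

(** The old tree consists of the edges avoiding the new vertex, and [u] is read off as the only
    neighbour of that vertex. Thus a grown tree determines its last step, which later lets point
    masses factor. *)
Lemma attach_inj G1 G2 u1 u2 :
  attach G1 u1 = attach G2 u2 -> G1 = G2 /\ u1 = u2.
Proof.
move=> eqG; split.
  by apply/setP => e; rewrite -(imset_widen_attach G1 u1) eqG imset_widen_attach.
by apply/eqP; rewrite -(adj_attach_max G2) -eqG adj_attach_max.
Qed.

(** The new vertex is a leaf: paths reach it through [u], and no cycle of length at least 3 passes
    through it. *)
Lemma is_tree_attach G u : is_tree G -> is_tree (attach G u).
Proof.
move=> [edge2 conn acyc]; split.
- move=> e /setUP[/imsetP[e' e'G ->]|/set1P ->].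
    by rewrite card_imset ?edge2 //; exact: widen_inj.
  by rewrite cards2 widen_neq_max.
- have connw x y : connect (adj (attach G u)) (w x) (w y).
    have /connectP[p pth ->] := conn x y; apply/connectP; exists (map w p).
      by apply: homo_path pth => a b; rewrite adj_attach_widen.
    by rewrite last_map.
  have sym := sym_connect_sym (@adj_sym _ (attach G u)).
  have connm x : connect (adj (attach G u)) (w x) ord_max.
    apply: connect_trans (connw x u) _.
    by apply: connect1; rewrite adj_sym adj_attach_max.
  move=> a b; case: (widenP a) => [|x]; case: (widenP b) => [|y] //.
  by rewrite sym.
- move=> c uc; have [c_max|c_nmax] := boolP (ord_max \in c).
    (* With the cycle rotated to start at the new vertex, its second and last entries are both
       neighbours of that vertex, hence both [w u]. In length 3 or more this contradicts
       uniqueness. *)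
    have [i c' eq_c] := rot_to c_max.
    rewrite -(size_rot i) eq_c; move: uc; rewrite -(rot_ucycle i) eq_c.
    move=> /andP[]; case: c' {eq_c} => [|a [|b s]] //=.
    rewrite rcons_path => /and4P[adj_a _ _ adj_l] /andP[_ /andP[a_notin _]].
    have nbr v : adj (attach G u) ord_max v -> v = w u.
      case: (widenP v) => [|x]; first by rewrite adj_attach_max_max.
      by rewrite adj_attach_max => /eqP ->.
    move: adj_l; rewrite adj_sym => /nbr eq_l.
    by rewrite (nbr _ adj_a) -eq_l mem_last in a_notin.
  have [c' eq_c] : exists c', c = map w c'.
    elim: c c_nmax {uc} => [|a c IH]; first by exists [::].
    rewrite inE negb_or => /andP[a_max /IH[c' ->]].
    by case: (widenP a) a_max => [/eqP//|x _]; exists (x :: c').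
  move: uc; rewrite eq_c size_map => /andP[cyc uniq_c]; apply: acyc.
  rewrite /ucycle -(map_inj_uniq widen_inj) uniq_c andbT.
  move: cyc; case: c' {eq_c uniq_c} => //= a s; rewrite -map_rcons path_map.
  by apply: sub_path => x y; rewrite /= adj_attach_widen.
Qed.

Lemma adj_relabel (s : 'S_n) G x y : adj (relabel s G) (s x) (s y) = adj G x y.
Proof.
rewrite /adj /relabel -(mem_imset (mem G) [set x; y] (imset_inj (@perm_inj _ s))).
by rewrite imsetU1 imset_set1.
Qed.

Lemma adj_relabelV (s : 'S_n) G x y :
  adj G (s^-1%g x) (s^-1%g y) = adj (relabel s G) x y.
Proof. by rewrite -{2}(permKV s x) -{2}(permKV s y) adj_relabel. Qed.

Lemma relabelM (s t : 'S_n) G : relabel (s * t)%g G = relabel t (relabel s G).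
Proof.
rewrite /relabel -imset_comp; apply: eq_imset => e /=.
by rewrite -imset_comp; apply: eq_imset => x; rewrite permM.
Qed.

Lemma relabel_inj (s : 'S_n) : injective (relabel s).
Proof. by apply: imset_inj; apply: imset_inj; exact: perm_inj. Qed.

Lemma is_tree_relabel (s : 'S_n) G : is_tree G -> is_tree (relabel s G).
Proof.
move=> [edge2 conn acyc]; split.
- by move=> e /imsetP[e' e'G ->]; rewrite card_imset ?edge2 //; exact: perm_inj.
- move=> x y; have /connectP[p pth eq_y] := conn (s^-1%g x) (s^-1%g y).
  apply/connectP; exists (map s p); last first.
    by rewrite -(permKV s x) last_map -eq_y; apply: esym (permKV s y).
  by rewrite -(permKV s x); apply: homo_path pth => a b; rewrite adj_relabel.
- move=> c /andP[cyc uniq_c]; rewrite -(size_map s^-1%g); apply: acyc.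
  rewrite /ucycle (map_inj_uniq (@perm_inj _ _)) uniq_c andbT.
  case: c cyc {uniq_c} => //= a c; rewrite -map_rcons path_map.
  by apply: sub_path => x y; rewrite /= adj_relabelV.
Qed.

(** This carries a symmetry through one growth step: the permutation is extended by fixing the new
    vertex, and the attachment point moves along. *)
Lemma relabel_attach (s : 'S_n) G u :
  relabel (lift_perm ord_max ord_max s) (attach G u) = attach (relabel s G) (s u).
Proof.
have liftw x : lift_perm ord_max ord_max s (w x) = w (s x).
  have lw z : w z = lift ord_max z by apply: val_inj; rewrite /= /bump leqNgt ltn_ord.
  by rewrite !lw lift_perm_lift.
rewrite /relabel /attach imsetU imset_set1; congr (_ :|: _); last first.
  by rewrite imsetU1 imset_set1 liftw lift_perm_id.
rewrite -!imset_comp; apply: eq_imset => e /=.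
by rewrite -!imset_comp; apply: eq_imset => x /=; rewrite liftw.
Qed.

End Graphs.

(** * The double star and the exchange of its two halves *)

Section DoubleStar.
Variables c l : nat.
Hypothesis lt_cl : c < l.

(* Edges point from each vertex k other than the centre c of the seed to its
   parent; [l] is the centre of the second star. *)
Definition ds_parent (k : nat) : nat := if k <= l then c else l.

Definition double_star m : graph m :=
  [set e | [exists x : 'I_m, exists y : 'I_m,
    [&& x != c :> nat, y == ds_parent x :> nat & e == [set x; y]]]].

Lemma double_starP m (e : {set 'I_m}) :
  reflect
    (exists x y : 'I_m, [/\ x <> c :> nat, y = ds_parent x :> nat & e = [set x; y]])
    (e \in double_star m).
Proof.
rewrite inE; apply: (iffP existsP) => [[x /existsP[y /and3P[xc yp /eqP ->]]]|].
  by exists x, y; split=> //; apply/eqP.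
by move=> [x [y [/eqP xc /eqP yp ->]]]; exists x; apply/existsP; exists y; apply/and3P.
Qed.

(** As [l <= m], the vertex [m] is neither [c] nor the parent of an earlier vertex, so the edge to
    its own parent is the only one it brings. *)
Lemma attach_double_star m (u : 'I_m) :
  l <= m -> u = ds_parent m :> nat -> attach (double_star m) u = double_star m.+1.
Proof.
move=> le_lm eq_u; apply/setP => e; apply/idP/idP.
  move=> /setUP[/imsetP[e' /double_starP[x [y [xc yp ->]]] ->]|/set1P ->];
    apply/double_starP.
    rewrite imsetU1 imset_set1.
    by exists (widen_ord (leqnSn m) x), (widen_ord (leqnSn m) y).
  by exists ord_max, (widen_ord (leqnSn m) u); split=> //=; [lia | exact: finset.setUC].
move=> /double_starP[x [y []]]; case: (widenP x) => [|{}x] /=;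
  case: (widenP y) => [|{}y] /=.
- by rewrite /ds_parent; case: ifP; lia.
- move=> _ eq_y ->; rewrite -/(adj _ _ _) adj_attach_max; apply/eqP/val_inj.
  by rewrite /= eq_y eq_u.
- by have := ltn_ord x; rewrite /ds_parent; case: ifP; lia.
- move=> xc yp ->; rewrite -/(adj _ _ _) adj_attach_widen.
  by apply/double_starP; exists x, y.
Qed.

(** The vertices below [l] and those from [l] on span two stars of equal size, with centres [c] and
    [l]; they are exchanged centre to centre. *)
Lemma double_star_swap m : m = 2 * l ->
  exists s : 'S_m, relabel s (double_star m) = double_star m
    /\ forall v : 'I_m, v < l -> l <= s v.
Proof.
move=> eq_m.
(* Exchanging c and 0 inside a star puts its centre first, as in the star on
   l, ..., 2l-1. *)
pose p k := if k == c then 0 else if k == 0 then c else k.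
pose f k := if k < l then l + p k else p (k - l).
have f_lt (i : 'I_m) : f i < m by have := ltn_ord i; rewrite /f /p; do ![case: ifP]; lia.
pose g i := Ordinal (f_lt i).
have gK : involutive g.
  move=> i; apply: val_inj; rewrite /= /f /p; have := ltn_ord i.
  by case: (i =P c :> nat) => ?; case: (i =P 0 :> nat) => ?; do ![case: ifP]; lia.
pose s := perm (inv_inj gK); exists s; split; last first.
  by move=> v lt_v; rewrite permE /= /f lt_v; lia.
(* Relabelling preserves the number of edges, so one inclusion suffices. *)
apply/eqP; rewrite eqEcard; apply/andP; split; last first.
  by rewrite card_imset //; apply: imset_inj; apply: perm_inj.
apply/fintype.subsetP => _ /imsetP[e /double_starP[x [y [xc yp ->]]] ->].
rewrite imsetU1 imset_set1; apply/double_starP.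
(* The edge joining the centres is mapped to itself with its ends exchanged, so child and parent
   trade places; on every other edge the orientation is kept. *)
have [eq_xl|neq_xl] := eqVneq (x : nat) l.
  exists (s y), (s x); rewrite finset.setUC !permE; split=> //.
    by move: yp; rewrite /= /ds_parent /f /p; do ![case: ifP]; lia.
  by move: yp; rewrite /= /ds_parent /f /p; do ![case: ifP]; lia.
exists (s x), (s y); rewrite !permE; split=> //; have := ltn_ord x.
  by rewrite /= /f /p; do ![case: ifP]; lia.
by move: yp; rewrite /= /ds_parent /f /p; do ![case: ifP]; lia.
Qed.

End DoubleStar.

(** Among vertices below [l], [ds_parent] is constantly [c], so [double_star c l l] is the star
    centred at [c]. *)
Lemma star_double_star l (S : graph l) : is_star S ->
  exists2 c, c < l & S = double_star c l l.
Proof.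
move=> [[edge2 _ _] [c [deg_c deg1]]]; exists c => //.
have edge_at x e : e \in S -> x \in e -> exists2 y, y != x & e = [set x; y].
  move=> eS xe; have /cards2P[a [b [ab eq_e]]] : #|e| == 2 by rewrite edge2.
  move: xe; rewrite eq_e => /set2P[] ->.
    by exists b; rewrite // eq_sym.
  by exists a; rewrite // finset.setUC.
have pair_inj : injective (fun v : 'I_l => [set c; v]).
  move=> u v /setP eq_uv; have := eq_uv u; have := eq_uv v.
  by rewrite !inE !eqxx !orbT => /orP[/eqP ->|/eqP->//] /esym /orP[/eqP->|/eqP].
(* The edges at [c] lie among the [l.-1] pairs [[set c; v]], and the degree of [c] is [l.-1], so
   every such pair is an edge. *)
have full v : v != c -> [set c; v] \in S.
  have sub : [set e in S | c \in e] \subset [set [set c; v] | v in [set~ c]].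
    apply/fintype.subsetP => e; rewrite inE => /andP[eS ce].
    by have [y yc ->] := edge_at _ _ eS ce; apply: imset_f; rewrite !inE.
  have /eqP eqS : [set e in S | c \in e] == [set [set c; v] | v in [set~ c]].
    rewrite eqEcard sub card_imset // cardsC1 card_ord.
    by move: deg_c; rewrite /degree => ->; rewrite leqnn.
  move=> vc; have : [set c; v] \in [set [set c; v] | v in [set~ c]].
    by apply: imset_f; rewrite !inE.
  by rewrite -eqS inE => /andP[].
apply/setP => e; apply/idP/double_starP => [eS|[x [y [xc yp ->]]]]; last first.
  have -> : y = c by apply: val_inj; rewrite /= yp /ds_parent (ltnW (ltn_ord x)).
  by rewrite finset.setUC full //; apply/eqP => /(congr1 val).
have [ce|c_e] := boolP (c \in e).
  have [y yc ->] := edge_at _ _ eS ce; exists y, c; rewrite finset.setUC; split=> //.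
    by apply/eqP.
  by rewrite /ds_parent (ltnW (ltn_ord y)).
(* A vertex [x] of an edge avoiding [c] would also lie on [[set c; x]], giving it two edges against
   its degree one. *)
have /card_gt0P[x xe] : 0 < #|e| by rewrite edge2.
have xc : x != c by apply: contraNneq c_e => <-.
have /eqP/cards1P[e0 deg_x] := deg1 x xc.
have : e \in [set e in S | x \in e] by rewrite inE eS.
have : [set c; x] \in [set e in S | x \in e] by rewrite inE full // !inE eqxx orbT.
rewrite deg_x !inE => /eqP <- /eqP eq_e.
by rewrite eq_e !inE eqxx in c_e.
Qed.

(** * Point masses of discrete random elements *)

Section DiscreteLaws.
Context {d : measure_display} {Omega : measurableType d} {R : realType}.
Variable P : probability Omega R.

Definition point_mass (T : Type) (X : Omega -> T) (x : T) : R :=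
  fine (P (X @^-1` [set x])%classic).

Lemma mass_ge0 T (X : Omega -> T) x : (0 <= point_mass X x)%R.
Proof. by rewrite fine_ge0. Qed.

Lemma mass_neq0 T (X : Omega -> T) x :
  (point_mass X x != 0)%R -> exists omega, X omega = x.
Proof.
apply: contraPP => noX; rewrite /point_mass (_ : _ @^-1` _ = set0)%classic.
  by rewrite measure0 eqxx.
by apply/seteqP; split=> // omega /= Xx; apply: noX; exists omega.
Qed.

Lemma discrete_pair (T1 T2 : finType) (X : Omega -> T1) (Y : Omega -> T2) :
  discrete_rv X -> discrete_rv Y -> discrete_rv (fun omega => (X omega, Y omega)).
Proof.
move=> mX mY B.
have -> : ((fun omega => (X omega, Y omega)) @^-1` B =
    \bigcup_(x in setT) (X @^-1` [set x] `&` Y @^-1` [set y | B (x, y)]))%classic.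
  apply/seteqP; split=> [omega BXY|omega [x _ [/= <-]]] //.
  by exists (X omega).
by apply: fin_bigcup_measurable => // x _; apply: measurableI.
Qed.

Lemma prob_sum_mass (T : finType) (Z : Omega -> T) (B : pred T) :
  discrete_rv Z ->
  P (Z @^-1` [set z | B z])%classic = (\sum_(z | B z) point_mass Z z)%:E%R.
Proof.
move=> mZ.
have -> : (Z @^-1` [set z | B z] = \bigcup_(z in [set z | B z]) Z @^-1` [set z])%classic.
  apply/seteqP; split=> [omega BZ|omega [z Bz /= ->]] //.
  by exists (Z omega).
rewrite measure_fin_bigcup; [|exact: finite_finset| |by move=> *; apply: mZ]; last first.
  by move=> x y _ _ [omega [/= <- <-]].
have -> : [set z | B z]%classic = [set` [seq z <- index_enum T | B z]]%classic.
  by apply/seteqP; split=> z /=; rewrite mem_filter mem_index_enum andbT.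
rewrite -sumEFin -fsbig_seq ?filter_uniq ?index_enum_uniq // big_filter.
by apply: eq_bigr => z _; rewrite fineK // fin_num_measure.
Qed.

Lemma uniform_mass (T : finType) (X : Omega -> T) x :
  uniform_rv P X -> point_mass X x = (#|T|%:R^-1)%R.
Proof. by case=> _ eqX; rewrite /point_mass eqX. Qed.

Lemma independent_mass (T1 T2 : Type) (X : Omega -> T1) (Y : Omega -> T2) x y :
  discrete_rv X -> discrete_rv Y ->
  independent_rv P X Y ->
  point_mass (fun omega => (X omega, Y omega)) (x, y)
  = (point_mass X x * point_mass Y y)%R.
Proof.
move=> mX mY indep; rewrite /point_mass -fineM ?fin_num_measure // -indep.
by congr (fine (P _)); apply/seteqP; split=> omega [] /= -> ->.
Qed.

Lemma mass_comp_inj (T1 T2 : Type) (X : Omega -> T1) (f : T1 -> T2) x :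
  injective f -> point_mass (f \o X) (f x) = point_mass X x.
Proof.
by move=> f_inj; congr (fine (P _)); apply/seteqP; split=> omega /= => [/f_inj|->].
Qed.

End DiscreteLaws.

(** * The numerical bound on the probability of the double star *)

Lemma prod_double_le l :
  0 < l -> 2 * \prod_(l <= i < 2 * l) i <= (2 * l) ^ l.
Proof.
move=> l_gt0; case: l l_gt0 => // l _; rewrite big_ltn; last lia.
rewrite mulnA expnS leq_mul //.
(* The factor 2 has turned the smallest factor into [2 * l.+1]; the other [l] factors are each below
   [2 * l.+1]. *)
have -> : (2 * l.+1) ^ l = \prod_(l.+2 <= i < 2 * l.+1) (2 * l.+1).
  by rewrite prod_nat_const_nat; congr (_ ^ _); lia.
by rewrite big_nat_cond [leqRHS]big_nat_cond leq_prod // => i; lia.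
Qed.

(* The hypothesis [eps < exp (- e^2)] means that [ln (ln (1 / eps)) > 2]. *)
Lemma prod_double_eps (R : realType) (eps : R) l :
  (0 < eps < expR (- expR 2))%R -> 0 < l ->
  (l%:R <= ln (1 / eps) / ln (ln (1 / eps)))%R ->
  (2 * eps <= (\prod_(l <= i < 2 * l) i)%N%:R^-1)%R.
Proof.
move=> /andP[eps_gt0 eps_lt] l_gt0; set L := ln _ => hl.
have expL : (expR L = eps^-1)%R by rewrite /L div1r lnK // posrE invr_gt0.
have L_gt : (expR 2 < L)%R.
  by rewrite -ltr_expR expL -[expR (expR 2)]invrK -expRN ltf_pV2 ?posrE ?expR_gt0.
have L_gt0 : (0 < L)%R by apply: lt_trans L_gt; rewrite expR_gt0.
have lnL : (2 < ln L)%R by rewrite -ltr_expR lnK.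
have lnL_gt0 : (0 < ln L)%R by apply: lt_trans lnL.
rewrite ler_pdivlMr // in hl.
have l2L : ((2 * l)%N%:R <= L)%R.
  by apply: le_trans hl; rewrite natrM mulrC ler_wpM2l // ltW.
(* [(2 * l) ^ l] is at most [L ^ l = exp (l * ln L)], and [l * ln L <= L] by the hypothesis on
   [l]. *)
have powL : (((2 * l) ^ l)%N%:R <= eps^-1)%R.
  rewrite natrX (le_trans (_ : _ <= L ^+ l)%R) ?lerXn2r ?nnegrE ?(ltW L_gt0) //.
  by rewrite -{1}(lnK L_gt0) -expRM_natl -expL ler_expR.
have prod_gt0 : (0 < (\prod_(l <= i < 2 * l) i)%N%:R :> R)%R.
  rewrite ltr0n big_seq_cond prodn_cond_gt0 // => i; rewrite mem_index_iota andbT.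
  by case/andP => + _; apply: leq_trans.
rewrite -[_^-1%R]mul1r ler_pdivlMr // in powL.
rewrite -[_^-1%R]mul1r ler_pdivlMr // mulrAC; apply: le_trans powL.
by rewrite ler_wpM2r ?(ltW eps_gt0) // -natrM ler_nat prod_double_le.
Qed.

(** * The law of the growing tree *)

Section Process.
Context {d : measure_display} {Omega : measurableType d} {R : realType}.
Variables (P : probability Omega R) (l : nat) (S : graph l) (n : nat).
Variables (T : forall i : nat, Omega -> graph i) (U : forall i : nat, Omega -> 'I_i.+1).
Hypothesis l_gt0 : 0 < l.
Hypothesis T_seed : forall omega, T l omega = S.
Hypothesis T_step : forall i : nat, l <= i.+1 < n ->
  [/\ uniform_rv P (U i),
      independent_rv P
        (fun omega => [seq (U j omega : nat) | j <- index_iota l.-1 i]) (U i)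
    & forall omega, T i.+2 omega = attach (T i.+1 omega) (U i omega)].

Lemma process_ind (Q : forall m, (Omega -> graph m) -> Prop) :
  Q l (fun=> S) ->
  (forall i, l <= i.+1 < n -> Q i.+1 (T i.+1) ->
    Q i.+2 (fun omega => attach (T i.+1 omega) (U i omega))) ->
  forall m, l <= m <= n -> Q m (T m).
Proof.
move=> Q0 QS; elim=> [|m IH] /andP[le_lm le_mn]; first lia.
have [eq_l|neq_l] := eqVneq l m.+1.
  by rewrite -eq_l (_ : T l = fun=> S) //; apply: funext.
case: m => [|i] in IH le_lm le_mn neq_l *; first lia.
have lt_in : l <= i.+1 < n by lia.
have [_ _ eqT] := T_step lt_in.
by rewrite (funext eqT); apply: QS => //; apply: IH; lia.
Qed.

Lemma process_tree m omega : is_tree S -> l <= m <= n -> is_tree (T m omega).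
Proof.
move=> treeS; apply: (process_ind (Q := fun m X => is_tree (X omega))) => //.
by move=> i _; apply: is_tree_attach.
Qed.

Lemma process_discrete m : l <= m <= n -> discrete_rv (T m).
Proof.
apply: (process_ind (Q := fun m X => discrete_rv X)) => [B|i lt_in mT B].
  by rewrite preimage_cst; case: ifP.
have [[mU _] _ _] := T_step lt_in.
exact: (discrete_pair mT mU (fun tu => B (attach tu.1 tu.2))).
Qed.

(** Independence is assumed between [U i] and the list of earlier choices; writing the tree as a
    function of that list transfers it to the tree. *)
Lemma process_history m : l <= m <= n ->
  exists F : seq nat -> graph m, forall omega,
    T m omega = F [seq (U j omega : nat) | j <- index_iota l.-1 m.-1].
Proof.
apply: (process_ind (Q := fun m X => exists F : seq nat -> graph m, forall omega,
    X omega = F [seq (U j omega : nat) | j <- index_iota l.-1 m.-1])).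
  by exists (fun=> S).
move=> i lt_in [F eqF].
(* The last entry of the list is the newest choice, decoded by [inord]; the remaining entries
   rebuild the previous tree. *)
exists (fun s => attach (F (rev (behead (rev s)))) (inord (head 0 (rev s)))) => omega.
have -> : index_iota l.-1 i.+2.-1 = rcons (index_iota l.-1 i) i.
  rewrite /index_iota [_.-1]/= subSn; last lia.
  by rewrite -addn1 iotaD cats1 subnKC; last lia.
by rewrite map_rcons rev_rcons /= revK -eqF inord_val.
Qed.

Lemma process_independent i :
  l <= i.+1 < n -> independent_rv P (T i.+1) (U i).
Proof.
move=> lt_in B C; have [_ indep _] := T_step lt_in.
have [|F eqF] := @process_history i.+1; first lia.
rewrite (_ : T i.+1 =
    F \o (fun omega => [seq (U j omega : nat) | j <- index_iota l.-1 i])).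
  by rewrite comp_preimage; apply: indep.
exact: funext.
Qed.

(** By [attach_inj] the grown tree has the given value exactly when the previous tree is [t] and the
    choice is [u]; these are independent and the choice is uniform. *)
Lemma process_mass i t u : l <= i.+1 < n ->
  point_mass P (T i.+2) (attach t u) = (point_mass P (T i.+1) t / i.+1%:R)%R.
Proof.
move=> lt_in; have [unifU _ eqT] := T_step lt_in.
pose att (tu : graph i.+1 * 'I_i.+1) := attach tu.1 tu.2.
have att_inj : injective att by move=> [t1 u1] [t2 u2] /attach_inj[] /= -> ->.
rewrite (_ : T i.+2 = att \o (fun omega => (T i.+1 omega, U i omega))); last first.
  exact: funext.
rewrite (mass_comp_inj P _ (t, u) att_inj).
rewrite independent_mass ?(uniform_mass _ unifU) ?card_ord //.
- by apply: process_discrete; lia.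
- by case: unifU.
- exact: process_independent.
Qed.

Lemma mass_double_star c m : c < l -> S = double_star c l l -> l <= m <= n ->
  point_mass P (T m) (double_star c l m) = ((\prod_(l <= i < m) i)%:R^-1)%R.
Proof.
move=> lt_cl eqS; elim: m => [|m IH] le_lmn; first lia.
have [eq_l|neq_l] := eqVneq l m.+1.
  rewrite -eq_l big_geq // invr1 -eqS /point_mass (_ : _ @^-1` _ = setT)%classic.
    by rewrite probability_setT.
  by apply/seteqP; split=> omega _ //=; apply: T_seed.
case: m => [|i] in IH le_lmn neq_l *; first lia.
have lt_par : ds_parent c l i.+1 < i.+1 by rewrite /ds_parent; case: ifP; lia.
rewrite -(attach_double_star lt_cl (u := Ordinal lt_par)) //; last lia.
rewrite process_mass; last lia.
rewrite IH; last lia.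
by rewrite [in RHS]big_nat_recr /= ?natrM ?invfM //; lia.
Qed.

(** Conditional invariance of the law, stated pointwise: [good] stands for the trees grown from the
    double star, and [q] for the probability of the double star. The last clause makes the seed
    disjoint from its image under [s]. *)
Definition swappable (q : R) m : Prop :=
  exists (s : 'S_m) (good : {set graph m}),
    [/\ forall t, t \in good ->
          point_mass P (T m) (relabel s t) = point_mass P (T m) t,
        (q <= \sum_(t in good) point_mass P (T m) t)%R
      & forall v : 'I_m, v < l -> l <= s v].

Lemma swappable_double m c : c < l -> S = double_star c l l ->
  m = 2 * l -> m <= n -> swappable ((\prod_(l <= i < 2 * l) i)%:R^-1)%R m.
Proof.
move=> lt_cl eqS eq_m le_mn; have [s [sD s_swap]] := double_star_swap lt_cl eq_m.
exists s, [set double_star c l m]; split=> //.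
  by move=> t /set1P ->; rewrite sD.
by rewrite big_set1 mass_double_star -?eq_m //; lia.
Qed.

(** The new vertex is fixed by the extended permutation, and the good trees are extended by every
    possible attachment. A good tree and its relabelling both split their mass uniformly over these
    attachments. *)
Lemma swappable_step q i :
  l <= i.+1 < n -> swappable q i.+1 -> swappable q i.+2.
Proof.
move=> lt_in [s [good [s_good q_le s_swap]]].
pose att (tu : graph i.+1 * 'I_i.+1) := attach tu.1 tu.2.
have att_inj : injective att by move=> [t1 u1] [t2 u2] /attach_inj[] /= -> ->.
exists (lift_perm ord_max ord_max s),
  [set att tu | tu in finset.setX good [set: 'I_i.+1]].
split.
- move=> _ /imsetP[[t u] /setXP[t_good _] ->].
  by rewrite relabel_attach !process_mass // s_good.
- rewrite big_imset; last by move=> ? ? _ _; apply: att_inj.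
  rewrite (eq_bigl (fun tu => (tu.1 \in good) && true)); last first.
    by move=> tu; rewrite !inE.
  rewrite -(pair_big (fun t => t \in good) xpredT
    (fun t u => point_mass P (T i.+2) (att (t, u)))).
  apply: le_trans q_le _; apply: ler_sum => t _; rewrite /att /=.
  (* Summing over the [i.+1] attachment points cancels the factor [1 / i.+1], so no mass is lost. *)
  under eq_bigr do rewrite process_mass //.
  by rewrite sumr_const card_ord -[leRHS]mulr_natr divfK ?pnatr_eq0.
- move=> v; case: (unliftP ord_max v) => [j|] ->.
    by rewrite lift_perm_lift !lift_max; apply: s_swap.
  by rewrite lift_perm_id => _; case/andP: lt_in.
Qed.

End Process.

(** * From the symmetry to the failure probability *)

(** A vertex of [H] in the seed is sent outside it, so the seed vertices in [s @: H] all come from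
    [H] minus the seed. *)
Lemma swap_card n l (H : {set 'I_n}) (s : 'S_n) :
  (forall v : 'I_n, v < l -> l <= s v) ->
  #|H :&: seed_vertices n l| + #|(s @: H) :&: seed_vertices n l| <= #|H|.
Proof.
move=> s_swap; rewrite -(cardsID (seed_vertices n l) H) leq_add2l.
rewrite -(card_imset (mem (H :\: _)) (@perm_inj _ s)); apply: subset_leq_card.
apply/fintype.subsetP => _ /setIP[/imsetP[v vH ->]]; rewrite inE => lt_sv.
rewrite imset_f // !inE vH andbT; apply/negP => /s_swap; lia.
Qed.

(** Pairing each outcome with its [swap], which has the same mass when the tree is good, at least
    one of the two is bad. Hence the good mass is at most twice the bad mass. *)
Lemma swap_output (d : measure_display) (Omega : measurableType d) (R : realType)
    (P : probability Omega R) (n l : nat) (X : Omega -> graph n) (sigma : Omega -> 'S_n)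
    (A : Omega -> {ffun graph n -> {set 'I_n}}) (s : 'S_n) (good : {set graph n}) :
  discrete_rv X -> (forall omega, is_tree (X omega)) ->
  seed_finding_algorithm P l X sigma A ->
  (forall t, t \in good -> point_mass P X (relabel s t) = point_mass P X t) ->
  (forall v : 'I_n, v < l -> l <= s v) ->
  (((\sum_(t in good) point_mass P X t) / 2)%:E <= P [set omega |
     (#|output X sigma A omega :&: seed_vertices n l|%:R <= l%:R / 2 :> R)%R]%classic)%E.
Proof.
move=> mX treeX [unifS indXS mA indA cardA] s_mass s_swap.
have mS : discrete_rv sigma by case: unifS.
pose Z omega := (X omega, sigma omega, A omega).
have mXS := discrete_pair mX mS.
have mZ : discrete_rv Z := discrete_pair mXS mA.
have massZ t p a :
    point_mass P Z (t, p, a)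
    = (point_mass P X t * #|{: 'S_n}|%:R^-1 * point_mass P A a)%R.
  by rewrite !independent_mass // (uniform_mass _ unifS).
pose out (z : graph n * 'S_n * {ffun graph n -> {set 'I_n}}) : {set 'I_n} :=
  z.1.2^-1%g @: z.2 (relabel z.1.2 z.1.1).
pose bad z := (#|out z :&: seed_vertices n l|%:R <= l%:R / 2 :> R)%R.
(* [swap] leaves the observed tree unchanged, but exchanges the seed with its
   image under [s]. *)
pose swap (z : graph n * 'S_n * {ffun graph n -> {set 'I_n}}) :=
  (relabel s z.1.1, s^-1%g * z.1.2, z.2)%g.
have out_swap z : out (swap z) = s @: out z.
  rewrite /out /swap /= -relabelM mulKVg -imset_comp; apply: eq_imset => v.
  by rewrite /= invMg invgK permM.
have swap_inj : injective swap.
  by move=> [[t p] a] [[t' p'] a'] [/relabel_inj -> /mulgI -> ->].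
have mass_swap z : z.1.1 \in good -> point_mass P Z (swap z) = point_mass P Z z.
  by case: z => [[t p] a] /= t_good; rewrite !massZ s_mass.
(* Only trees yield outputs of size [l]; nonzero mass ensures that [z] is attained, so its first
   component is a tree. *)
have bad_or z : point_mass P Z z != 0%R -> bad z || bad (swap z).
  move=> nz; have [omega eqz] := mass_neq0 nz.
  have card_out : #|out z| = l.
    rewrite /out card_imset; last exact: perm_inj.
    by rewrite -eqz /= cardA //; apply: is_tree_relabel; apply: treeX.
  have := swap_card (out z) s_swap; rewrite card_out -out_swap.
  rewrite -(ler_nat R) natrD /bad => le_l.
  case: lerP => //= lt1; case: lerP => //= lt2.
  by move: le_l; rewrite leNgt [X in (X < _)%R]splitr ltrD.
have sum_good : (\sum_(t in good) point_mass P X t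
    = \sum_(z | z.1.1 \in good) point_mass P Z z)%R.
  by apply: EFin_inj; rewrite -!prob_sum_mass.
rewrite (prob_sum_mass P bad mZ) lee_fin ler_pdivrMr // sum_good.
(* One of the two copies of the bad mass is reindexed along the bijection [swap], so that the
   comparison can be made term by term. *)
have -> : ((\sum_(z | bad z) point_mass P Z z) * 2 =
    \sum_(z | bad z) point_mass P Z z
    + \sum_(z | bad (swap z)) point_mass P Z (swap z))%R.
  by rewrite -(reindex_inj swap_inj (P := bad)) mulr_natr.
rewrite big_mkcond [X in (_ <= X + _)%R]big_mkcond [X in (_ <= _ + X)%R]big_mkcond.
rewrite -big_split; apply: ler_sum => z _ /=.
case: ifP => [/mass_swap ->|_]; last by do 2![case: ifP]; rewrite ?addr_ge0 ?mass_ge0.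
have [->|/bad_or] := eqVneq (point_mass P Z z) 0%R; first by rewrite !if_same addr0.
have := mass_ge0 P Z z.
by case: (bad z) (bad (swap z)) => [] [] //=; lra.
Qed.

Theorem theorem4 (R : realType) (eps : R)
    (heps : (0 < eps < expR (- expR 2))%R)
    (l : nat) (hl1 : 1 <= l)
    (hl : (l%:R <= ln (1 / eps) / ln (ln (1 / eps)))%R)
    (S : graph l) (hS : is_star S)
    (n : nat) (hn : 2 * l <= n)
    (d : measure_display) (Omega : measurableType d) (P : probability Omega R)
    (T : forall i : nat, Omega -> graph i)
    (hT : uniform_attachment P S n T)
    (sigma : Omega -> 'S_n) (A : Omega -> {ffun graph n -> {set 'I_n}})
    (hA : seed_finding_algorithm P l (T n) sigma A) :
  (eps%:E <= P [set omega |
     (#|output (T n) sigma A omega :&: seed_vertices n l|%:R <= l%:R / 2 :> R)%R]%classic)%E.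
Proof.
have [T_seed [U T_step]] := hT.
have [c lt_cl eqS] := star_double_star hS.
set q := (\prod_(l <= i < 2 * l) i)%:R^-1%R : R.
(* The induction starts at the double star on [2 * l] vertices and follows the growth up to time
   [n]. *)
have swap_n m : 2 * l <= m <= n -> swappable P l T q m.
  elim: m => [|m IH] le_m; first lia.
  have [eq_m|neq_m] := eqVneq m.+1 (2 * l).
    by apply: (swappable_double hl1 T_seed T_step lt_cl eqS); lia.
  case: m => [|i] in IH le_m neq_m *; first lia.
  by apply: (swappable_step hl1 T_seed T_step); [lia | apply: IH; lia].
have [|s [good [s_good q_le s_swap]]] := swap_n n; first by rewrite hn leqnn.
have le_ln : l <= n <= n by lia.
have treeS : is_tree S by case: hS.
apply: le_trans (swap_output (process_discrete hl1 T_seed T_step le_ln)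
  (fun omega => process_tree hl1 T_seed T_step omega treeS le_ln) hA
  s_good s_swap).
rewrite lee_fin ler_pdivlMr // mulrC; apply: le_trans q_le.
exact: prod_double_eps.
Qed.
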